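(* Let $G$ be a connected graph of order $n$. Then $\operatorname{th}_+(G)=n$ if and only if $G=K_n$ (up to isomorphism).
   Context: All graphs are finite, simple and undirected. $K_n$ is the complete graph on $n$ vertices. Positive semidefinite (PSD) color change rule: each vertex of $G$ is blue or white; let $B$ be the current set of blue vertices and let $W_1,\dots,W_k$ be the vertex sets of the connected components of $G-B$. A white vertex $w\in W_i$ is colored blue (is forced by the blue vertex $v$) when $w$ is the only white neighbor of $v$ in the induced subgraph $G[W_i\cup B]$. Starting with exactly the vertices of $S\subseteq V(G)$ blue, at each time step all possible forces are performed simultaneously. $S$ is a PSD zero forcing set if eventually all vertices become blue; in that case $\operatorname{pt}_+(G;S)$ is the number of time steps needed to color all vertices blue (so it is $0$ if $S=V(G)$), and otherwise $\operatorname{pt}_+(G;S)=\infty$. Define $\operatorname{th}_+(G;S)=|S|+\operatorname{pt}_+(G;S)$, and the PSD throttling number $\operatorname{th}_+(G)=\min\{\operatorname{th}_+(G;S): S \text{ is a PSD zero forcing set of } G\}$. *)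

(* Defs.v *)
From mathcomp Require Import all_boot.

Set Implicit Arguments.
Unset Strict Implicit.
Unset Printing Implicit Defensive.

Record sgraph := SGraph {
  vertex :> finType;
  adj : rel vertex;
  adj_sym : symmetric adj;
  adj_irrefl : irreflexive adj }.

Definition connected_graph (G : sgraph) : Prop :=
  forall x y : G, connect (@adj G) x y.

Definition graph_iso (G H : sgraph) : Prop :=
  exists f : G -> H, bijective f /\ forall x y : G, adj (f x) (f y) = adj x y.

Lemma neq_sym (T : eqType) : symmetric (fun x y : T => x != y).
Proof. by move=> x y; rewrite eq_sym. Qed.

Lemma neq_irrefl (T : eqType) : irreflexive (fun x y : T => x != y).
Proof. by move=> x; rewrite eqxx. Qed.

Definition complete_graph (n : nat) : sgraph :=
  @SGraph 'I_n (fun x y => x != y) (@neq_sym _) (@neq_irrefl _).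

Section PSDForcing.
Variable G : sgraph.
Implicit Types (B W S : {set G}) (v w : G).

Definition white_adj B : rel G :=
  [rel x y | [&& x \notin B, y \notin B & adj x y]].

Definition white_components B : {set {set G}} :=
  equivalence_partition (connect (white_adj B)) (~: B).

(* The set below consists of the white neighbours of v in G[W :|: B]. *)
Definition psd_forces_in B W v w : bool :=
  [&& v \in B, w \in W &
      [set u in W :|: B | adj v u & u \notin B] == [set w]].

Definition psd_forces B v w : bool :=
  [exists W in white_components B, psd_forces_in B W v w].

Definition psd_step B : {set G} :=
  B :|: [set w | [exists v, psd_forces B v w]].

Definition psd_blue S (t : nat) : {set G} := iter t psd_step S.

(* Decidable form of "all vertices are eventually blue"; see psd_forcing_setP *)
Definition psd_forcing_set S : bool := fconnect psd_step S setT.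

Lemma psd_forcing_setP S :
  reflect (exists t, psd_blue S t == setT) (psd_forcing_set S).
Proof.
apply: (iffP idP) => [h | [t /eqP h]].
  by exists (findex psd_step S setT); apply/eqP/iter_findex.
by rewrite /psd_forcing_set -h; apply: fconnect_iter.
Qed.

(* None stands for infinity. *)
Definition psd_pt S : option nat :=
  match psd_forcing_setP S with
  | ReflectT ex_t => Some (ex_minn ex_t)
  | ReflectF _ => None
  end.

Definition psd_th_of S : option nat := omap (addn #|S|) (psd_pt S).

Lemma psd_th_ex :
  exists k, [exists S, psd_forcing_set S && (psd_th_of S == Some k)].
Proof.
have h : psd_forcing_set setT by apply: connect0.
case E: (psd_th_of setT) => [k|].
  by exists k; apply/existsP; exists setT; rewrite h E eqxx.
move: E; rewrite /psd_th_of /psd_pt.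
by case: psd_forcing_setP => // nex; case: nex; exists 0; apply/eqP.
Qed.

Definition psd_th : nat := ex_minn psd_th_ex.

End PSDForcing.

(* Main.v *)
Require Import Defs.
From mathcomp Require Import all_boot.

Set Implicit Arguments.
Unset Strict Implicit.
Unset Printing Implicit Defensive.

(** The starting set of all vertices costs n, so the question is whether any
    other set does better.

    In a complete graph the white vertices always form a single component, all
    of it adjacent to every blue vertex, so nothing is forced while two vertices
    are white ([step_stuck]). A forcing set therefore omits at most one vertex,
    and omitting one costs a time step: every forcing set costs at least n.

    In a connected graph that is not complete, adjacency is not transitive on
    distinct vertices, so there are adjacent pairs u, v and v, w with u and w
    distinct and nonadjacent ([induced_path3]). When only u and w are white, each
    is a component by itself, and v forces both in the same step. This costs
    (n - 2) + 1 < n ([th_induced_path3]). *)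

Section PSDThrottling.
Variable G : sgraph.
Implicit Types (B S : {set G}) (u v w x y : G).

Lemma psd_th_le S t : psd_blue S t = setT -> psd_th G <= #|S| + t.
Proof.
move=> blueT.
have fS : psd_forcing_set S by apply/psd_forcing_setP; exists t; apply/eqP.
have [k [Sk k_le]] : exists k, psd_th_of S = Some k /\ k <= #|S| + t.
  rewrite /psd_th_of /psd_pt; case: psd_forcing_setP => [ex_t|]; last first.
    by case; exists t; apply/eqP.
  case: ex_minnP => m _ m_min; exists (#|S| + m); split=> //.
  by rewrite leq_add2l m_min ?blueT.
rewrite /psd_th; case: ex_minnP => m _ m_min; apply: leq_trans k_le.
by apply: m_min; apply/existsP; exists S; rewrite fS Sk eqxx.
Qed.

Lemma psd_th_attained :
  exists S t, psd_blue S t = setT /\ psd_th G = #|S| + t.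
Proof.
rewrite /psd_th; case: ex_minnP => k /existsP[S /andP[_ /eqP]] + _.
rewrite /psd_th_of /psd_pt; case: psd_forcing_setP => //= ex_t.
by case: ex_minnP => t /eqP blueT _ [<-]; exists S, t.
Qed.

(** All white vertices are pairwise adjacent, so they lie in one component, and
    any blue vertex sees both [x] and [y] there. *)
Lemma step_stuck B x y :
  (forall u v, u != v -> adj u v) ->
  x \notin B -> y \notin B -> x != y -> psd_step B = B.
Proof.
move=> complG xB yB neq_xy; apply/setUidPl/subsetP => w; rewrite inE.
case/existsP=> v /existsP[W /andP[/imsetP[z _ ->]]].
case/and3P=> vB; rewrite !inE => /andP[wB zw] /eqP seen.
have [w' w'B neq_w] : exists2 w', w' \notin B & w' != w.
  by have [<-|] := eqVneq x w; [exists y; rewrite // eq_sym | exists x].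
have : w' \in [set w].
  rewrite -seen !inE w'B andbT complG ?andbT; last first.
    by apply: contraNneq w'B => <-.
  have ww' : white_adj B w w' by apply/and3P; split; rewrite // complG // eq_sym.
  by rewrite /= (connect_trans zw (connect1 ww')).
by rewrite inE (negPf neq_w).
Qed.

Lemma th_complete : (forall u v, u != v -> adj u v) -> psd_th G = #|G|.
Proof.
move=> complG; apply/eqP; rewrite eqn_leq; apply/andP; split.
  by rewrite -cardsT -[#|setT|]addn0; apply: psd_th_le.
have [S [t [blueT ->]]] := psd_th_attained.
rewrite -(cardsC S) leq_add2l.
have whites_le1 : #|~: S| <= 1.
  apply/card_le1_eqP => x y; rewrite !inE => xS yS; apply: contraTeq isT => neq.
  have := iter_fix t (step_stuck complG yS xS neq).
  by rewrite [iter _ _ _]blueT => eqS; rewrite -eqS inE in xS.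
case: t blueT => [/= ->|t _]; first by rewrite setCT cards0.
exact: leq_trans whites_le1 _.
Qed.

(** A white vertex without white neighbours is a component by itself, so it is
    the only white vertex that its blue neighbours see there. *)
Lemma forces_isolated B v x :
  v \in B -> x \notin B -> adj v x ->
  (forall y, y \notin B -> ~~ adj x y) -> psd_forces B v x.
Proof.
move=> vB xB adj_vx isol_x.
have reach y : connect (white_adj B) x y = (y == x).
  apply/idP/eqP => [/connectP[[|z p] /= + ->] // | ->]; last exact: connect0.
  by case/andP=> /and3P[_ zB]; rewrite (negPf (isol_x z zB)).
apply/existsP; exists [set y in ~: B | connect (white_adj B) x y].
apply/andP; split; first by apply: imset_f; rewrite inE.
rewrite /psd_forces_in vB !inE xB reach eqxx /=.
apply/eqP/setP=> y; rewrite !inE reach.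
have [->|_] := eqVneq y x; first by rewrite xB adj_vx.
by rewrite andbF /=; case: (y \in B); rewrite ?andbF.
Qed.

Lemma th_induced_path3 u v w :
  adj u v -> adj v w -> u != w -> ~~ adj u w -> psd_th G < #|G|.
Proof.
move=> uv vw neq_uw nadj_uw; pose B := ~: [set u; w].
have whiteE y : (y \notin B) = (y == u) || (y == w) by rewrite !inE negbK.
have vB : v \in B.
  rewrite -[_ \in _]negbK whiteE negb_or; apply/andP; split.
    by apply: contraTneq uv => ->; rewrite adj_irrefl.
  by apply: contraTneq vw => ->; rewrite adj_irrefl.
have force_u : psd_forces B v u.
  apply: forces_isolated => //; rewrite ?whiteE ?eqxx // 1?adj_sym //.
  by move=> y; rewrite whiteE => /orP[]/eqP-> //; rewrite adj_irrefl.
have force_w : psd_forces B v w.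
  apply: forces_isolated => //; rewrite ?whiteE ?eqxx ?orbT //.
  by move=> y; rewrite whiteE => /orP[]/eqP->; rewrite ?adj_irrefl // adj_sym.
have blueT : psd_blue B 1 = setT.
  apply/setP=> y; rewrite in_setT; apply/setUP.
  have [yB|white_y] := boolP (y \in B); [by left | right; rewrite inE].
  by apply/existsP; exists v; move: white_y; rewrite whiteE => /orP[]/eqP->.
apply: leq_ltn_trans (psd_th_le blueT) _.
by rewrite -(cardsC B) setCK cards2 neq_uw ltn_add2l.
Qed.

(** Without such an induced path, adjacency-or-equality is transitive, hence
    contains the connectivity relation. *)
Lemma induced_path3 x y :
  connect (@adj G) x y -> x != y -> ~~ adj x y ->
  exists u v w, [/\ adj u v, adj v w, u != w & ~~ adj u w].
Proof.
case/connectP=> p + ->; elim: p x => [|z p IHp] x /=; first by rewrite eqxx.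
case/andP=> xz path_p neq_x nadj_x.
have [eq_z|neq_z] := eqVneq z (last z p).
  by move: nadj_x; rewrite -eq_z xz.
have [adj_z|nadj_z] := boolP (adj z (last z p)).
  by exists x, z, (last z p).
exact: IHp path_p neq_z nadj_z.
Qed.

Lemma graph_iso_complete :
  graph_iso G (complete_graph #|G|) <-> forall u v, u != v -> adj u v.
Proof.
split=> [[f [bij_f fE]] u v | complG].
  by rewrite -fE /= (inj_eq (bij_inj bij_f)).
exists enum_rank; split=> [|x y]; first exact: enum_rank_bij.
rewrite /= (inj_eq enum_rank_inj).
by have [->|/complG ->] := eqVneq x y; rewrite ?adj_irrefl.
Qed.

End PSDThrottling.

Theorem proposition5p5 (G : sgraph) (n : nat) (cardG : #|G| = n)
    (connG : connected_graph G) :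
  psd_th G = n <-> graph_iso G (complete_graph n).
Proof.
subst n; split=> [thG | /graph_iso_complete]; last exact: th_complete.
apply/graph_iso_complete => x y neq_xy; apply: contraT => nadj_xy.
have [u [v [w [uv vw uw nuw]]]] := induced_path3 (connG x y) neq_xy nadj_xy.
by have := th_induced_path3 uv vw uw nuw; rewrite thG ltnn.
Qed.
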